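(* For every finite data set $X\subset\mathbb{R}^d$ and every set of $k$ distinct centers $C=\{c^1,\dots,c^k\}\subset\mathbb{R}^d$, the random threshold tree $\mathcal{T}$ produced by the RandomCoordinateCut algorithm (defined in the context) satisfies $$\mathbf{E}[\mathrm{cost}(X,\mathcal{T})]\le(2\ln k+2)\cdot\sum_{x\in X}\min_{c\in C}\|x-c\|_1.$$
   Context: A threshold cut is a pair $(j,\theta)$ with $j\in[d]$, $\theta\in\mathbb{R}$; it splits a region into the part with $x_j\le\theta$ and the part with $x_j>\theta$. A threshold decision tree is a binary tree whose internal nodes carry threshold cuts, so each leaf corresponds to an axis-aligned rectangular region; a tree with $k$ leaves partitions $X$ into clusters $P_1,\dots,P_k$ (the points of $X$ in each leaf region). Its $k$-medians cost is $\mathrm{cost}(X,\mathcal{T})=\sum_{i=1}^k\min_{\hat c^i\in\mathbb{R}^d}\sum_{x\in P_i}\|x-\hat c^i\|_1$. RandomCoordinateCut: let $M=\max_{i,j}|c^i_j|$. Start with a tree consisting of a root to which all centers $c^1,\dots,c^k$ are assigned. While some leaf contains at least two distinct centers: pick $j\in[d]$ uniformly at random and $\theta$ uniformly at random in $(-M,M)$ (independently of everything else); for every leaf $u$ with center set $C_u$, let $\mathrm{Left}=\{c\in C_u:c_j\le\theta\}$, $\mathrm{Right}=\{c\in C_u:c_j>\theta\}$; if both are nonempty, give $u$ a left child (subregion $x_j\le\theta$, centers $\mathrm{Left}$) and a right child (subregion $x_j>\theta$, centers $\mathrm{Right}$). The output is the final tree $\mathcal{T}$ (each leaf contains exactly one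 center). *)

(* Defs.v *)
(* Mathematical Components, with MathComp-Analysis for probability. *)
From HB Require Import structures.
From mathcomp Require Export all_boot all_order all_algebra.
From mathcomp Require Export finmap.
From mathcomp Require Export all_classical all_reals all_analysis.
Import Order.TTheory GRing.Theory Num.Theory.

Set Implicit Arguments.
Unset Strict Implicit.
Unset Printing Implicit Defensive.

Local Open Scope classical_set_scope.
Local Open Scope fset_scope.
Local Open Scope ring_scope.

(* A point of R^d is a row vector; its j-th coordinate is [x 0 j]. *)
Definition l1norm (R : realType) (d : nat) (x : 'rV[R]_d) : R :=
  \sum_(j < d) `|x 0 j|.

(* [inf] is a minimum here: C is finite, and is meant to be nonempty. *)
Definition dist_to_centers (R : realType) (d : nat) (C : {fset 'rV[R]_d})
    (x : 'rV[R]_d) : R :=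
  inf [set l1norm (x - c) | c in [set` C]].

(* [inf] is a minimum here too, attained at a coordinatewise median of P;
   the center ranges over the whole space, not only over a given set. *)
Definition median_cost (R : realType) (d : nat) (P : {fset 'rV[R]_d}) : R :=
  inf (range (fun c : 'rV[R]_d => \sum_(x <- P) l1norm (x - c))).

(* [Node j theta l r] sends [x 0 j <= theta] to l and [theta < x 0 j] to r;
   a leaf records the centers assigned to it. *)
Inductive tree (R : realType) (d : nat) : Type :=
| Leaf of {fset 'rV[R]_d}
| Node of 'I_d & R & tree R d & tree R d.
Arguments Leaf {R d}.
Arguments Node {R d}.

Definition lower_part (R : realType) (d : nat) (j : 'I_d) (theta : R)
    (P : {fset 'rV[R]_d}) : {fset 'rV[R]_d} :=
  [fset x in P | x 0 j <= theta].

Definition upper_part (R : realType) (d : nat) (j : 'I_d) (theta : R)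
    (P : {fset 'rV[R]_d}) : {fset 'rV[R]_d} :=
  [fset x in P | theta < x 0 j].

Fixpoint clusters (R : realType) (d : nat) (X : {fset 'rV[R]_d})
    (t : tree R d) : seq {fset 'rV[R]_d} :=
  match t with
  | Leaf _ => [:: X]
  | Node j theta l r =>
      clusters (lower_part j theta X) l ++ clusters (upper_part j theta X) r
  end.

Definition tree_cost (R : realType) (d : nat) (X : {fset 'rV[R]_d})
    (t : tree R d) : R :=
  \sum_(P <- clusters X t) median_cost P.

Fixpoint leaf_centers (R : realType) (d : nat) (t : tree R d) :
    seq {fset 'rV[R]_d} :=
  match t with
  | Leaf Cu => [:: Cu]
  | Node _ _ l r => leaf_centers l ++ leaf_centers r
  end.

Fixpoint split_leaves (R : realType) (d : nat) (j : 'I_d) (theta : R)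
    (t : tree R d) : tree R d :=
  match t with
  | Leaf Cu =>
      let Left := lower_part j theta Cu in
      let Right := upper_part j theta Cu in
      if (Left != fset0) && (Right != fset0)
      then Node j theta (Leaf Left) (Leaf Right)
      else Leaf Cu
  | Node j' theta' l r =>
      Node j' theta' (split_leaves j theta l) (split_leaves j theta r)
  end.

Definition finished (R : realType) (d : nat) (t : tree R d) : bool :=
  all (fun Cu : {fset 'rV[R]_d} => (#|` Cu| <= 1)%N) (leaf_centers t).

Fixpoint tree_after (R : realType) (d : nat) (C : {fset 'rV[R]_d})
    (j : nat -> 'I_d) (theta : nat -> R) (n : nat) : tree R d :=
  match n with
  | 0%N => Leaf C
  | m.+1 => split_leaves (j m) (theta m) (tree_after C j theta m)
  end.

(* The tree at the exit of the loop when round n draws the cut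
   [(j n, theta n)]; [None] if the loop never exits. *)
Definition random_coordinate_cut (R : realType) (d : nat)
    (C : {fset 'rV[R]_d}) (j : nat -> 'I_d) (theta : nat -> R) :
    option (tree R d) :=
  match pselect (exists n, finished (tree_after C j theta n)) with
  | left h => Some (tree_after C j theta (ex_minn h))
  | right _ => None
  end.

(* A run that does not terminate costs +oo, so that a finite expected cost
   entails almost sure termination. *)
Definition output_cost (R : realType) (d : nat) (X : {fset 'rV[R]_d})
    (o : option (tree R d)) : \bar R :=
  if o is Some t then (tree_cost X t)%:E else +oo%E.

Definition max_coord (R : realType) (d : nat) (C : {fset 'rV[R]_d}) : R :=
  \big[Num.max/0]_(c <- C) \big[Num.max/0]_(j < d) `|c 0 j|.

Definition mutually_independent (disp : measure_display)
    (T : measurableType disp) (R : realType) (P : probability T R)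
    (I : choiceType) (F : I -> set (set T)) : Prop :=
  forall (J : {fset I}) (E : I -> set T),
    (forall i, i \in J -> F i (E i)) ->
    P (\bigcap_(i in [set` J]) E i) = (\prod_(i <- J) P (E i))%E.

(* The events generated by the coordinate of round n ([inl n]) and by the
   threshold of round n ([inr n]). *)
Definition draw_events (disp : measure_display) (T : measurableType disp)
    (R : realType) (d : nat) (j : nat -> T -> 'I_d) (theta : nat -> T -> R)
    (i : nat + nat) : set (set T) :=
  match i with
  | inl n => [set j n @^-1` B | B in [set: set 'I_d]]
  | inr n => [set theta n @^-1` A | A in measurable]
  end.

(* The law of the thresholds is constrained only when -M < M: if M = 0 there
   is at most one center and the algorithm draws no cut. *)
Record uniform_cuts (disp : measure_display) (T : measurableType disp)
    (R : realType) (P : probability T R) (d : nat) (M : R)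
    (j : nat -> T -> 'I_d) (theta : nat -> {RV P >-> R}) : Prop := {
  coord_measurable : forall n (B : set 'I_d), measurable (j n @^-1` B);
  coord_uniform : forall n (i : 'I_d), P (j n @^-1` [set i]) = (d%:R^-1)%:E;
  threshold_uniform : forall n (ltM : - M < M) (A : set R), measurable A ->
    distribution P (theta n) A = uniform_prob ltM A;
  draws_independent :
    mutually_independent P (draw_events j (fun n => theta n : T -> R))
}.

(* Main.v *)
Require Import Defs.
From mathcomp Require Import measurable_realfun ring lra.
Import Order.TTheory GRing.Theory Num.Theory.
Set Implicit Arguments.
Unset Strict Implicit.
Unset Printing Implicit Defensive.

(* Fix a data point x and let A be the set of centers in its leaf. A cut (j, theta)
   cuts off the set S of centers lying on the other side of x, and A becomes
   A \ S unless A is contained in S; so x ends up with the last surviving center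
   of a random elimination game. Let mu be the law of S, q(A) ([winner A]) the law
   of the winner from A, p the center closest to x, and D(i) = mu(i in S, p notin S) ([loss]),
   so that the normalized excess distance of i over p is at most D(i).
   Put F(A) = sum_i q_i(A) D(i) ([mean_loss]) and G(A) = 1 + H(q(A)) ([potential]),
   H the entropy, with G = 0 on the empty set. Since q is harmonic, concavity of -t ln t makes G decrease
   along the game at rate at least F, if cuts avoiding p may empty A. Hence
   F(A) <= sum_(S containing p) mu(S) G(A \ S) ([exposure]) whenever p is in A, by induction on
   #|A|. As H <= ln k, the expected excess is at most (1 + ln k) |x - p|.
   The expectation of sum_i q_i(A_n) |x - i| does not depend on the round n, and
   the tree is almost surely finished at some round, so Fatou's lemma transfers
   the bound to the cost of the output. *)

(** * The elimination game *)

Section RandomElimination.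
Local Open Scope ring_scope.
Local Open Scope set_scope.
Local Notation empty := finset.set0.
Context {R : realType} {K : finType} (mu : {set K} -> R).

Definition survivors (A S : {set K}) : {set K} :=
  if A :\: S == empty then A else A :\: S.

(** Exactly the cuts under which [survivors] changes [A]. *)
Definition splits (A S : {set K}) : bool :=
  (A :&: S != empty) && (A :\: S != empty).

(** A cut that does not split [A] is an idle round, so the law is conditioned on the first splitting
    cut; hence the quotient by the total mass of these cuts. The first argument is fuel: a splitting
    cut shrinks [A], so [#|A|] units suffice. *)
Fixpoint winner_rec (n : nat) (A : {set K}) (i : K) : R :=
  if n is m.+1 then
    if (#|A| <= 1)%N then (i \in A)%:R
    else (\sum_(S | splits A S) mu S * winner_rec m (A :\: S) i)
         / \sum_(S | splits A S) mu S
  else (i \in A)%:R.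

Definition winner (A : {set K}) : K -> R := winner_rec #|A| A.

Context (mu_ge0 : forall S, 0 <= mu S).
Context (mu_splits : forall A : {set K},
  (1 < #|A|)%N -> 0 < \sum_(S | splits A S) mu S).

Lemma splits_card A S : splits A S -> (#|A :\: S| < #|A|)%N.
Proof.
case/andP=> AS0 _; rewrite -(cardsID S A) -[ltnLHS]add0n ltn_add2r card_gt0.
exact: AS0.
Qed.

Lemma survivors_sub (A S : {set K}) : survivors A S \subset A.
Proof. by rewrite /survivors; case: ifP => // _; exact: finset.subsetDl. Qed.

Lemma winner_rec_stable n m (A : {set K}) i : (#|A| <= n)%N -> (#|A| <= m)%N ->
  winner_rec n A i = winner_rec m A i.
Proof.
elim: n m A => [|n IHn] [|m] A //=.
- by move=> A0 _; rewrite (leq_trans A0).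
- by move=> _ A0; rewrite (leq_trans A0).
move=> An Am; case: ifPn => // _; congr (_ / _); apply: eq_bigr => S AS.
congr (_ * _); apply: IHn; rewrite -ltnS.
  exact: leq_trans (splits_card AS) An.
exact: leq_trans (splits_card AS) Am.
Qed.

Lemma winner_small (A : {set K}) i : (#|A| <= 1)%N -> winner A i = (i \in A)%:R.
Proof. by rewrite /winner; case: {2}#|A| => //= n ->. Qed.

Lemma winner_step (A : {set K}) i : (1 < #|A|)%N ->
  winner A i = (\sum_(S | splits A S) mu S * winner (A :\: S) i)
               / \sum_(S | splits A S) mu S.
Proof.
move=> A1; rewrite {1}/winner -(prednK (ltnW A1)) /= leqNgt A1 /=.
congr (_ / _); apply: eq_bigr => S AS; congr (_ * _).
apply: winner_rec_stable => //.
by rewrite -ltnS (prednK (ltnW A1)) splits_card.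
Qed.

Lemma winner_ge0 A i : 0 <= winner A i.
Proof.
rewrite /winner; elim: #|A| {2}A => /= [|n IHn] {}A; first exact: ler0n.
case: ifP => _; rewrite ?ler0n// divr_ge0 ?sumr_ge0// => S _.
by rewrite mulr_ge0.
Qed.

Lemma winner_notin (A : {set K}) i : i \notin A -> winner A i = 0.
Proof.
rewrite /winner; elim: #|A| {1 3}A => /= [|n IHn] {}A iA.
  by rewrite (negbTE iA).
rewrite (negbTE iA); case: ifP => // _.
rewrite big1 ?mul0r// => S _; rewrite IHn ?mulr0//.
by rewrite inE (negbTE iA) andbF.
Qed.

Lemma winner_sum A : A != empty -> \sum_i winner A i = 1.
Proof.
have [n] := ubnP #|A|; elim: n A => // n IHn A /ltnSE An A0.
have [A1|A1] := leqP #|A| 1.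
  have /cards1P[a ->] : #|A| == 1%N by rewrite eqn_leq A1 card_gt0.
  rewrite (bigD1 a)//= big1 => [|i ia]; first by rewrite winner_small ?cards1// set11 addr0.
  by rewrite winner_notin// inE.
under eq_bigr do rewrite winner_step//.
rewrite -mulr_suml exchange_big /=.
under eq_bigr => S AS.
  rewrite -mulr_sumr IHn ?mulr1; first over.
    by apply: leq_trans An; exact: splits_card.
  by case/andP: AS.
by rewrite divff// gt_eqF// mu_splits.
Qed.

Lemma winner_le1 A i : winner A i <= 1.
Proof.
have [->|A0] := eqVneq A empty.
  by rewrite winner_notin ?inE// ler01.
by rewrite -(winner_sum A0) (bigD1 i)//= lerDl sumr_ge0// => k _; exact: winner_ge0.
Qed.

(** Cuts that miss [A] contribute zero, and over the splitting cuts the identity is [winner_step]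
    with its denominator cleared. A set of at most one element has no splitting cut. *)
Lemma winner_harmonic A i :
  \sum_(S | A :\: S != empty) mu S * (winner (A :\: S) i - winner A i) = 0.
Proof.
have same S : A :&: S = empty -> A :\: S = A.
  by move=> AS; apply/finset.setDidPl; rewrite -setI_eq0 AS.
have [A1|A1] := leqP #|A| 1.
  rewrite big1// => S ASn0; rewrite same ?subrr ?mulr0//.
  apply/eqP; rewrite -cards_eq0 -leqn0 -(leq_add2r #|A :\: S|) cardsID add0n.
  by apply: leq_trans A1 _; rewrite card_gt0.
rewrite (bigID (fun S => A :&: S != empty)) /= [X in _ + X]big1 => [|S /andP[_]]; last first.
  by rewrite negbK => /eqP /same ->; rewrite subrr mulr0.
rewrite addr0; under eq_bigl do rewrite andbC.
under eq_bigr do rewrite mulrBr.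
rewrite sumrB -mulr_suml (winner_step i A1) mulrCA divff ?mulr1 ?subrr//.
by rewrite gt_eqF// mu_splits.
Qed.

(** Harmonicity becomes a vanishing sum of nonnegative terms. This serves the boundary case of
    [entropy_drift], since [- t ln t] has no finite tangent slope at 0. *)
Lemma winner_setD A S i : A :\: S != empty -> mu S != 0 -> winner A i = 0 ->
  winner (A :\: S) i = 0.
Proof.
move=> AS S0 A0.
have : \sum_(T | A :\: T != empty) mu T * winner (A :\: T) i = 0.
  rewrite -[RHS](winner_harmonic A i); apply: eq_bigr => T _.
  by rewrite A0 subr0.
move/psumr_eq0P => /(_ _ S AS) /eqP; rewrite mulf_eq0 (negbTE S0) => /= H.
by apply/eqP/H => T _; rewrite mulr_ge0 ?winner_ge0.
Qed.

(** The right side is the tangent at [q] of the concave function [- t ln t]; for positive [t] the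
    inequality is [ln u <= u - 1] at [u = q / t]. *)
Lemma xlnx_tangent (t q : R) : 0 <= t -> 0 < q ->
  - (t * ln t) <= - (t * ln q) + q - t.
Proof.
rewrite le_eqVlt => /predU1P[<- q0|t0 q0]; first by rewrite !mul0r oppr0 add0r addr0 ltW.
have : ln (q / t) <= q / t - 1.
  have := expR_ge1Dx (ln (q / t)); rewrite lnK ?posrE ?divr_gt0//; lra.
rewrite ln_div ?posrE// => /(ler_wpM2l (ltW t0)).
rewrite !mulrBr mulrCA divff ?gt_eqF// !mulr1; lra.
Qed.

(** The constant 1 makes the potential fall by at least 1 when a cut empties [A]; this pays for such
    cuts in [potential_drift]. *)
Definition potential (A : {set K}) : R :=
  if A == empty then 0 else 1 + \sum_i - (winner A i * ln (winner A i)).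

Lemma entropy_ge0 A : 0 <= \sum_i - (winner A i * ln (winner A i)).
Proof.
apply: sumr_ge0 => i _; rewrite oppr_ge0 mulr_ge0_le0 ?winner_ge0//.
by apply: ln_le0; exact: winner_le1.
Qed.

Lemma potential_ge0 A : 0 <= potential A.
Proof.
by rewrite /potential; case: ifP => // _; rewrite addr_ge0// entropy_ge0.
Qed.

(** Gibbs' inequality: each entropy term is compared with its tangent at the uniform weight
    [1 / #|K|], and the linear corrections sum to zero. *)
Lemma potential_le A : (0 < #|K|)%N -> potential A <= 1 + ln #|K|%:R.
Proof.
move=> K0; have k0 : 0 < #|K|%:R :> R by rewrite ltr0n.
rewrite /potential; case: ifPn => [_|A0].
  by rewrite addr_ge0// ln_ge0// ler1n.
rewrite lerD2l.
have /le_trans -> // : \sum_i - (winner A i * ln (winner A i)) <=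
    \sum_i (- (winner A i * ln #|K|%:R^-1) + #|K|%:R^-1 - winner A i).
  by apply: ler_sum => i _; rewrite xlnx_tangent ?winner_ge0 ?invr_gt0.
rewrite sumrB big_split /= sumrN -mulr_suml winner_sum// sumr_const cardT -cardE.
by rewrite -[_^-1 *+ _]mulr_natr mulVf ?gt_eqF// lnV ?posrE// mul1r opprK addrK.
Qed.

(* Replace [t |-> - t ln t] by its tangent at [winner A i]: the linear part
   cancels by harmonicity. *)
Lemma entropy_drift A i :
  \sum_(S | A :\: S != empty) mu S *
    (- (winner (A :\: S) i * ln (winner (A :\: S) i)) + winner A i * ln (winner A i))
  <= - (winner A i * \sum_(S | (A :\: S != empty) && (i \in S)) mu S).
Proof.
have [A0|/eqP A0] := eqVneq (winner A i) 0.
  rewrite A0 !mul0r oppr0 big1// => S AS.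
  have [->|S0] := eqVneq (mu S) 0; first by rewrite mul0r.
  by rewrite winner_setD// mul0r oppr0 addr0 mulr0.
have q0 : 0 < winner A i by rewrite lt_neqAle winner_ge0 andbT eq_sym; apply/eqP.
pose q := winner A i.
apply: (@le_trans _ _ (\sum_(S | A :\: S != empty) mu S *
   (- (ln q + 1) * (winner (A :\: S) i - q) - q * (i \in S)%:R))).
  apply: ler_sum => S AS; rewrite ler_wpM2l//.
  (* If [i] is cut off, its weight becomes 0, where the tangent exceeds the function by exactly [q];
     this slack is the whole gain. *)
  have [iS|iS] := boolP (i \in S).
    rewrite winner_notin ?inE ?iS//= -/q mulr1; lra.
  have := xlnx_tangent (winner_ge0 (A :\: S) i) q0; rewrite -/q mulr0; lra.
under eq_bigr do rewrite mulrBr mulrCA.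
rewrite sumrB -mulr_sumr winner_harmonic mulr0 sub0r lerN2 big_mkcondr mulr_sumr /=.
apply: ler_sum => S _; rewrite mulrCA; case: (i \in S); by rewrite ?mulr1 ?mulr0.
Qed.

Context (p : K).

Definition loss (i : K) : R := \sum_(S : {set K} | (i \in S) && (p \notin S)) mu S.

Definition mean_loss (A : {set K}) : R := \sum_i winner A i * loss i.

(** A cut counted in [loss i] either empties [A], and is paid for by the constant 1 in [potential],
    or leaves something, and is paid for by the entropy drift of coordinate [i]. *)
Lemma potential_drift A : A != empty ->
  \sum_(S : {set K} | p \notin S) mu S * (potential (A :\: S) - potential A) +
  \sum_(S : {set K} | (p \in S) && (A :\: S != empty)) mu S * (potential (A :\: S) - potential A)
  <= - mean_loss A.
Proof.
move=> A0.
pose cover := \sum_(S : {set K} | (p \notin S) && (A :\: S == empty)) mu S.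
pose hit i := \sum_(S : {set K} | (A :\: S != empty) && (i \in S)) mu S.
have potE : potential A = 1 + \sum_i - (winner A i * ln (winner A i)).
  by rewrite /potential (negbTE A0).
rewrite (bigID (fun S : {set K} => A :\: S == empty)) /= -addrA.
rewrite (eq_bigr (fun S : {set K} => mu S * - potential A)) => [|S /andP[_ AS]]; last first.
  by rewrite /potential AS sub0r.
rewrite -mulr_suml -/cover mulrN.
set X := (X in _ + X <= _).
have -> : X = \sum_(S : {set K} | A :\: S != empty) mu S * (potential (A :\: S) - potential A).
  rewrite (bigID (fun S : {set K} => p \notin S)) /X /=; congr (_ + _); apply: eq_bigl => S.
    by rewrite andbC.
  by rewrite negbK andbC.
have {X} -> : \sum_(S : {set K} | A :\: S != empty) mu S * (potential (A :\: S) - potential A) =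
   \sum_i \sum_(S : {set K} | A :\: S != empty) mu S *
    (- (winner (A :\: S) i * ln (winner (A :\: S) i)) + winner A i * ln (winner A i)).
  rewrite exchange_big /=; apply: eq_bigr => S AS.
  rewrite -mulr_sumr; congr (_ * _); rewrite potE /potential (negbTE AS) big_split /=.
  rewrite opprD addrACA subrr add0r; congr (_ + _).
  by rewrite -sumrN; apply: eq_bigr => i _; rewrite opprK.
apply: (@le_trans _ _ (- cover - \sum_i winner A i * hit i)).
  apply: lerD.
    rewrite lerN2 ler_peMr ?sumr_ge0// potE lerDl; exact: entropy_ge0.
  by rewrite -sumrN; apply: ler_sum => i _; exact: entropy_drift.
(* [cover] is distributed over the coordinates with the winner probabilities, whose sum is 1. *)
rewrite -opprD lerN2 -[cover]mul1r -(winner_sum A0) mulr_suml -big_split /=.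
apply: ler_sum => i _; rewrite -mulrDr ler_wpM2l ?winner_ge0//.
rewrite /loss (bigID (fun S : {set K} => A :\: S == empty)) /=; apply: lerD.
  rewrite /cover [leRHS]big_mkcond [leLHS]big_mkcond; apply: ler_sum => S _.
  by case: (i \in S); case: (p \notin S); case: (_ == _) => //=.
rewrite /hit [leRHS]big_mkcond [leLHS]big_mkcond; apply: ler_sum => S _.
by case: (i \in S); case: (p \notin S); case: (_ == _) => //=.
Qed.

Definition exposure (A : {set K}) : R := \sum_(S : {set K} | p \in S) mu S * potential (A :\: S).

Lemma exposure_ge0 A : 0 <= exposure A.
Proof. by apply: sumr_ge0 => S _; rewrite mulr_ge0// potential_ge0. Qed.

Lemma exposureE A : exposure A =
  \sum_(S : {set K} | (p \in S) && (A :\: S != empty)) mu S * potential (A :\: S).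
Proof.
rewrite /exposure big_mkcondr; apply: eq_bigr => S _; case: ifPn => //.
by rewrite negbK => /eqP ->; rewrite /potential eqxx mulr0.
Qed.

Lemma mean_loss_harmonic A :
  \sum_(S : {set K} | A :\: S != empty) mu S * (mean_loss (A :\: S) - mean_loss A) = 0.
Proof.
under eq_bigr => S _ do rewrite /mean_loss -sumrB mulr_sumr.
rewrite exchange_big big1// => i _.
under eq_bigr do rewrite -mulrBl mulrA.
by rewrite -mulr_suml winner_harmonic mul0r.
Qed.

(* The interactions of pairs of cuts that contain [p] cancel by antisymmetry. *)
Lemma exposure_drift A :
  \sum_(S : {set K} | p \notin S) mu S * (exposure (A :\: S) - exposure A) +
  \sum_(S : {set K} | (p \in S) && (A :\: S != empty)) mu S * (mean_loss (A :\: S) - exposure A)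
  <= 0.
Proof.
pose P (S : {set K}) := (p \in S) && (A :\: S != empty).
(* The removals of [S] and [N] commute, so the drift of [exposure] is a weighted sum over [N] of
   drifts of [potential] at [A :\: N]. Both potentials vanish when [A :\: N] is empty. *)
have -> : \sum_(S : {set K} | p \notin S) mu S * (exposure (A :\: S) - exposure A) =
    \sum_(N : {set K} | P N) mu N *
      \sum_(S : {set K} | p \notin S) mu S * (potential (A :\: N :\: S) - potential (A :\: N)).
  under eq_bigr do rewrite /exposure -sumrB mulr_sumr.
  rewrite exchange_big /= /P big_mkcondr; apply: eq_bigr => N _.
  rewrite mulr_sumr; case: ifPn => [_|].
    apply: eq_bigr => S _; rewrite -mulrBr mulrCA; congr (_ * (_ * (potential _ - _))).
    by rewrite !finset.setDDl finset.setUC.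
  rewrite negbK => AN; apply: big1 => S _.
  have /eqP -> : A :\: S :\: N == empty.
    by rewrite finset.setDDl finset.setUC -finset.setDDl (eqP AN) finset.set0D.
  by rewrite (eqP AN) subrr mulr0.
rewrite -big_split /=; under eq_bigr do rewrite -mulrDr.
apply: (@le_trans _ _ (\sum_(N : {set K} | P N) mu N *
    \sum_(S : {set K} | P S) mu S * (potential (A :\: N) - potential (A :\: S)))).
  (* [potential_drift] is applied to [A :\: N]; in its second sum the nonnegative potentials after
     the cut are dropped, which leaves [potential (A :\: N)] weighted by cuts in [P]. *)
  apply: ler_sum => N /andP[pN AN]; rewrite ler_wpM2l//.
  have := potential_drift AN; set X := \sum_(S : {set K} | p \notin S) _; set Y := \sum_(S : {set K} | _) _.
  have -> : exposure A = \sum_(S : {set K} | P S) mu S * potential (A :\: S) by exact: exposureE.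
  under [X in _ -> _ <= X]eq_bigr do rewrite mulrBr.
  rewrite sumrB.
  suff : - Y <= \sum_(S : {set K} | P S) mu S * potential (A :\: N) by lra.
  rewrite /Y -sumrN [leLHS]big_mkcond [leRHS]big_mkcond; apply: ler_sum => S _.
  rewrite /P; case: (p \in S) => //=; case: ifPn => [ANS|_].
    have -> : A :\: S != empty.
      apply: contra_neq ANS => AS.
      by rewrite finset.setDDl finset.setUC -finset.setDDl AS finset.set0D.
    rewrite -mulrN opprB ler_wpM2l// gerBl; exact: potential_ge0.
  by case: ifP => _ //; rewrite mulr_ge0// potential_ge0.
under eq_bigr do rewrite mulr_sumr.
have anti : \sum_(N : {set K} | P N) \sum_(S : {set K} | P S)
      mu N * (mu S * (potential (A :\: N) - potential (A :\: S)))
   = - \sum_(N : {set K} | P N) \sum_(S : {set K} | P S)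
      mu N * (mu S * (potential (A :\: N) - potential (A :\: S))).
  rewrite {1}exchange_big /= -sumrN; apply: eq_bigr => N _.
  rewrite -sumrN; apply: eq_bigr => S _; ring.
by move: anti; lra.
Qed.

(** By harmonicity, the gap at [A] times the splitting mass is the sum of
    [mean_loss (A :\: S) - exposure A] over splitting cuts. When [S] avoids [p], induction replaces
    [mean_loss] by [exposure] at [A :\: S]; the result is the left side of [exposure_drift]. *)
Lemma mean_loss_le_exposure (A : {set K}) : p \in A -> mean_loss A <= exposure A.
Proof.
have [n] := ubnP #|A|; elim: n A => // n IHn A /ltnSE An pA.
have [A1|A1] := leqP #|A| 1.
  rewrite /mean_loss big1 ?exposure_ge0// => i _; rewrite winner_small//.
  have [iA|iA] := boolP (i \in A); last by rewrite mul0r.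
  have -> : i = p by apply: (card_le1_eqP A1).
  by rewrite /loss big1 ?mulr0// => S; case: (p \in S).
have r0 := mu_splits A1.
have drift := exposure_drift A; have harm := mean_loss_harmonic A.
have AS0 (S : {set K}) : A :&: S = empty -> A :\: S = A.
  by move=> AS; apply/finset.setDidPl; rewrite -setI_eq0 AS.
have AS1 (S : {set K}) : p \notin S -> A :\: S != empty.
  by move=> pS; apply/set0Pn; exists p; rewrite inE pS.
rewrite -subr_le0 -(pmulr_rle0 _ r0).
apply: le_trans drift.
have -> : (\sum_(S | splits A S) mu S) * (mean_loss A - exposure A) =
    \sum_(S | splits A S) mu S * (mean_loss (A :\: S) - exposure A).
  rewrite mulr_suml; apply/eqP; rewrite -subr_eq0 -oppr_eq0 opprB -sumrB; apply/eqP.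
  rewrite -[RHS]harm /splits [LHS]big_mkcondl; apply: eq_bigr => S _; case: ifPn => [_|].
    by rewrite -mulrBr; congr (_ * _); ring.
  by rewrite negbK => /eqP/AS0 ->; rewrite subrr mulr0.
rewrite (bigID (fun S : {set K} => p \notin S)) /=; apply: lerD.
  rewrite [leLHS]big_mkcond [leRHS]big_mkcond; apply: ler_sum => S _.
  have [pS|] := boolP (p \notin S); last by rewrite andbF.
  rewrite andbT; case: ifPn => [sS|]; last first.
    by rewrite /splits AS1// andbT negbK => /eqP/AS0 ->; rewrite subrr mulr0.
  rewrite ler_wpM2l// lerD2r IHn ?inE ?pS//.
  by apply: leq_trans An; exact: splits_card.
(* A cut containing [p] meets [A], so it splits [A] as soon as something is left: the two sums have
   the same index set. *)
rewrite le_eqVlt; apply/orP; left; apply/eqP/eq_bigl => S.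
rewrite negbK andbC; have [pS|//] := boolP (p \in S).
rewrite /splits /= andbC; case: (_ :\: _ != _) => //=.
by apply/set0Pn; exists p; rewrite inE pA.
Qed.

Lemma mean_loss_le :
  mean_loss [set: K] <= (1 + ln #|K|%:R) * \sum_(S : {set K} | p \in S) mu S.
Proof.
apply: le_trans (mean_loss_le_exposure (finset.in_setT p)) _.
rewrite /exposure mulrC mulr_suml; apply: ler_sum => S _.
by rewrite ler_wpM2l// potential_le//; apply/card_gt0P; exists p.
Qed.
End RandomElimination.

(** * Finite words of independent letters and the sets they leave *)

Section RandomWords.
Local Open Scope ring_scope.
Local Open Scope set_scope.
Local Notation empty := finset.set0.
Context {R : realType} {K L : finType} (pr : L -> R) (cut : L -> {set K}).

Fixpoint words (n : nat) : seq (seq L) :=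
  if n is m.+1 then [seq rcons s l | s <- words m, l <- enum L] else [:: [::]].

Definition run (A : {set K}) (s : seq L) : {set K} :=
  foldl (fun B l => survivors B (cut l)) A s.

Lemma run_rcons A s l : run A (rcons s l) = survivors (run A s) (cut l).
Proof. by rewrite /run -cats1 foldl_cat. Qed.

Definition mean_run (n : nat) (f : {set K} -> R) : R :=
  \sum_(s <- words n) (\prod_(l <- s) pr l) * f (run [set: K] s).

Definition cut_law (S : {set K}) : R := \sum_(l | cut l == S) pr l.

Lemma mem_words n s : (s \in words n) = (size s == n).
Proof.
elim: n s => [|n IHn] s /=; first by rewrite inE size_eq0.
apply/allpairsP/eqP => [[[u l] /= [us _ ->]]|].
  by rewrite size_rcons; congr _.+1; apply/eqP; rewrite -IHn.
case/lastP: s => [//|s l]; rewrite size_rcons => -[sn].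
by exists (s, l); rewrite mem_enum IHn sn.
Qed.

Lemma uniq_words n : uniq (words n).
Proof.
elim: n => //= n IHn; apply: allpairs_uniq => //; first exact: enum_uniq.
by move=> [s l] [t m] _ _ /= /rcons_inj [-> ->].
Qed.

Lemma mean_runS n f :
  mean_run n.+1 f = mean_run n (fun A => \sum_S cut_law S * f (survivors A S)).
Proof.
rewrite /mean_run /= big_allpairs_dep; apply: eq_bigr => s _.
rewrite mulr_sumr big_enum /=.
rewrite (partition_big cut predT) //=; apply: eq_bigr => S _.
rewrite mulrA -mulrA mulr_suml mulr_sumr; apply: eq_bigr => l /eqP <-.
by rewrite -cats1 big_cat big_seq1 cats1 run_rcons mulrA.
Qed.

Lemma eq_mean_run n f g : f =1 g -> mean_run n f = mean_run n g.
Proof. by move=> fg; apply: eq_bigr => s _; rewrite fg. Qed.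

Context (pr_ge0 : forall l, 0 <= pr l) (pr_sum : \sum_l pr l = 1).
Context (cut_law_splits : forall A : {set K},
  (1 < #|A|)%N -> 0 < \sum_(S | splits A S) cut_law S).

Lemma cut_law_ge0 S : 0 <= cut_law S.
Proof. by apply: sumr_ge0 => l _. Qed.

Lemma cut_law_sum : \sum_S cut_law S = 1.
Proof. by rewrite -pr_sum [RHS](partition_big cut predT). Qed.

Lemma le_mean_run n f g : (forall A, f A <= g A) -> mean_run n f <= mean_run n g.
Proof.
move=> fg; apply: ler_sum => s _; rewrite ler_wpM2l//.
by apply: prodr_ge0 => l _.
Qed.

(** The winning probability of [i] is a martingale along the game: by harmonicity its mean increment
    vanishes, covering cuts leaving the set as it is. *)
Lemma mean_run_winner n i :
  mean_run n (fun A => winner cut_law A i) = winner cut_law [set: K] i.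
Proof.
elim: n => [|n IHn]; first by rewrite /mean_run big_seq1 big_nil mul1r.
rewrite mean_runS -[RHS]IHn; apply: eq_mean_run => A.
rewrite -[RHS]mul1r -cut_law_sum mulr_suml; apply/eqP; rewrite -subr_eq0; apply/eqP.
rewrite -sumrB -[RHS](winner_harmonic cut_law_splits A i) [RHS]big_mkcond.
apply: eq_bigr => S _; rewrite /survivors; case: eqP => _ /=; last by rewrite mulrBr.
by rewrite subrr.
Qed.

Lemma mean_run_sum (I : finType) n (f : I -> {set K} -> R) :
  mean_run n (fun A => \sum_i f i A) = \sum_i mean_run n (f i).
Proof.
rewrite /mean_run; under eq_bigr do rewrite mulr_sumr.
by rewrite exchange_big.
Qed.

Lemma mean_runZ n a f : mean_run n (fun A => f A * a) = mean_run n f * a.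
Proof.
by rewrite /mean_run mulr_suml; apply: eq_bigr => s _; rewrite mulrA.
Qed.

Lemma mean_run_decay : exists2 r : R, 0 <= r < 1 &
  forall n, mean_run n (fun A => (1 < #|A|)%N%:R) <= #|K|%:R * r ^+ n.
Proof.
have [e e0 eP] : exists2 e : R, 0 < e & forall A : {set K}, (1 < #|A|)%N ->
    e <= \sum_(S | splits A S) cut_law S.
  (* A minimum of finitely many positive numbers and the default 1. *)
  exists (\big[Num.min/1]_(A : {set K} | (1 < #|A|)%N) \sum_(S | splits A S) cut_law S).
    by apply: lt_bigmin => // A A1; exact: cut_law_splits.
  by move=> A A1; exact: bigmin_le_cond.
have [K1|K1] := leqP #|K| 1.
  exists 0; first by rewrite lexx ltr01.
  move=> n; rewrite /mean_run big1 ?mulr_ge0 ?exprn_ge0 ?ler0n// => s _.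
  by rewrite ltnNge (leq_trans (max_card _) K1) mulr0.
have k0 : 0 < #|K|%:R :> R by rewrite ltr0n ltnW.
(* This dominates the indicator of [1 < #|A|], drops by at least 1 at a split and is at most [#|K|],
   so a mean drop of [e] is a relative drop of at least [e / #|K|]. *)
pose f (A : {set K}) : R := (#|A|.-1)%:R.
have e1 : e <= 1.
  have /eP /le_trans -> // : (1 < #|[set: K]|)%N by rewrite cardsT.
  rewrite -cut_law_sum [leLHS]big_mkcond; apply: ler_sum => S _.
  by case: ifP => _ //; exact: cut_law_ge0.
have ek : e / #|K|%:R <= 1.
  by rewrite ler_pdivrMr// mul1r (le_trans e1)// ler1n ltnW.
exists (1 - e / #|K|%:R); first by rewrite subr_ge0 ek/= ltrBlDr ltrDl divr_gt0.
have step A : \sum_S cut_law S * f (survivors A S) <= f A * (1 - e / #|K|%:R).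
  have [A1|A1] := leqP #|A| 1.
    have fA S : f (survivors A S) = 0.
      have : (#|survivors A S| <= 1)%N.
        exact: leq_trans (subset_leq_card (survivors_sub _ _)) A1.
      by rewrite /f; case: #|_| => [|[|]].
    have -> : f A = 0 by rewrite /f; move: A1; case: #|A| => [|[|]].
    by rewrite mul0r big1// => S _; rewrite fA mulr0.
  apply: (@le_trans _ _ (f A - e)).
    apply: (@le_trans _ _ (\sum_S (cut_law S * f A - cut_law S * (splits A S)%:R))).
      apply: ler_sum => S _; rewrite -mulrBr ler_wpM2l ?cut_law_ge0// /survivors.
      have [sS|nS] := boolP (splits A S).
        have /andP[_ /negbTE ->] := sS.
        rewrite /f lerBrDr -natrD ler_nat addn1.
        have := splits_card sS; have /andP[_] := sS; rewrite -card_gt0.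
        by case: #|A| => // m; case: #|_|.
      rewrite subr0; case: ifP => // _; rewrite ler_nat.
      by rewrite -!subn1 leq_sub2r// subset_leq_card// finset.subsetDl.
    rewrite sumrB -mulr_suml cut_law_sum mul1r lerD2l lerN2.
    apply: le_trans (eP A A1) _; rewrite [leLHS]big_mkcond; apply: ler_sum => S _.
    by case: ifP; rewrite ?mulr1 ?mulr0.
  rewrite mulrBr mulr1 lerD2l lerN2 mulrCA ger_pMr// ler_pdivrMr// mul1r ler_nat.
  exact: leq_trans (leq_pred _) (max_card _).
have decay n : mean_run n f <= #|K|%:R * (1 - e / #|K|%:R) ^+ n.
  elim: n => [|n IHn].
    rewrite /mean_run big_seq1 big_nil mul1r expr0 mulr1 ler_nat.
    exact: leq_trans (leq_pred _) (max_card _).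
  rewrite mean_runS exprSr mulrA; apply: le_trans (le_mean_run _ step) _.
  by rewrite mean_runZ ler_wpM2r// subr_ge0.
move=> n; apply: le_trans (decay n); apply: le_mean_run => A.
by rewrite ler_nat; case: #|A| => [|[|]].
Qed.
End RandomWords.

(** * Measure-theoretic preliminaries *)

Section Measure.
Import numFieldNormedType.Exports.
Local Open Scope classical_set_scope.
Local Open Scope ring_scope.

(** The integral of a nonnegative function is the supremum over the simple functions below it, and
    that family grows with the function. It is applied to [output_cost], whose measurability is
    never established. *)
Lemma le_integral_ge0 d (T : measurableType d) (R : realType)
    (mu : {measure set T -> \bar R}) (f g : T -> \bar R) :
  (forall x, 0 <= f x)%E -> (forall x, f x <= g x)%E ->
  (\int[mu]_x f x <= \int[mu]_x g x)%E.
Proof.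
move=> f0 fg; rewrite !ge0_integralTE//; last by move=> x; exact: le_trans (fg x).
apply: le_ereal_sup => _ [h hf <-]; exists h => // x.
exact: le_trans (hf x) (fg x).
Qed.

Lemma measurable_finType_valued d (T : measurableType d) (F : finType) (g : T -> F)
    (D : pred F) : (forall y, measurable (g @^-1` [set y])) ->
  measurable [set x | D (g x)].
Proof.
move=> mg; rewrite (_ : [set x | D (g x)] = \bigcup_(y in [set` D]) (g @^-1` [set y])).
  by apply: fin_bigcup_measurable => //; exact: finite_finpred.
by apply/seteqP; split=> [x Dx|x [y Dy gxy]]; [exists (g x)|rewrite /= gxy].
Qed.

Lemma measure_finType_valued d (T : measurableType d) (R : realType)
    (Q : {measure set T -> \bar R}) (F : finType) (g : T -> F) (D : pred F) :
  (forall y, measurable (g @^-1` [set y])) ->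
  (Q [set x | D (g x)] = \sum_(y | D y) Q (g @^-1` [set y]))%E.
Proof.
move=> mg; rewrite (_ : [set x | D (g x)] = \bigcup_(y in [set` D]) (g @^-1` [set y])).
  rewrite measure_fin_bigcup//.
    rewrite -(@bigfs _ _ _ _ (index_enum F)) ?index_enum_uniq// => i _.
    by rewrite mem_index_enum.
  by apply/trivIsetP => y z _ _ /eqP yz; apply/seteqP; split=> // x [/= -> /yz].
by apply/seteqP; split=> [x Dx|x [y Dy gxy]]; [exists (g x)|rewrite /= gxy].
Qed.

(** * Uniform mass of half-open intervals *)

Section Uniform.
Context {R : realType} (a b : R) (ab : a < b).
Let U := uniform_prob ab.

Lemma uniform_probE A : measurable A ->
  (U A = (b - a)^-1%:E * lebesgue_measure (A `&` `[a, b]))%E.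
Proof.
move=> mA; rewrite /U /uniform_prob integral_uniform_pdf.
rewrite -integral_cst; last exact: measurableI.
apply: eq_integral => x; rewrite inE => -[_ /=]; rewrite in_itv /= /uniform_pdf.
by move=> ->.
Qed.

(** The interval may stick out of [[a, b]], as happens when a data point lies outside the range of
    the centers; the matching lower bound requires it to stay inside. *)
Lemma uniform_prob_itv_le (x y : R) A : measurable A -> x <= y -> A `<=` `[x, y[ ->
  fine (U A) <= (y - x) / (b - a).
Proof.
move=> mA xy Axy; have ba : 0 < b - a by rewrite subr_gt0.
rewrite -lee_fin fineK ?fin_num_measure// uniform_probE// mulrC EFinM.
rewrite lee_pmul2l ?lte_fin ?invr_gt0//.
apply: (@le_trans _ _ (lebesgue_measure (`[x, y[ : set R))).
  by apply: le_measure; rewrite ?inE//; [exact: measurableI|apply: subIset; left].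
rewrite lebesgue_measure_itv /= lte_fin; case: ifPn => // _.
by rewrite lee_fin subr_ge0.
Qed.

Lemma uniform_prob_itv_ge (x y : R) A : measurable A -> a <= x -> y <= b ->
  `[x, y[ `<=` A -> (y - x) / (b - a) <= fine (U A).
Proof.
move=> mA ax yb xyA; have ba : 0 < b - a by rewrite subr_gt0.
rewrite -lee_fin fineK ?fin_num_measure// uniform_probE// mulrC EFinM.
rewrite lee_pmul2l ?lte_fin ?invr_gt0//.
apply: (@le_trans _ _ (lebesgue_measure (`[x, y[ : set R))).
  rewrite lebesgue_measure_itv /= lte_fin; case: ifPn => //.
  by rewrite -leNgt lee_fin subr_le0.
apply: le_measure; rewrite ?inE//; first exact: measurableI.
move=> t xyt; split; first exact: xyA.
move: xyt; rewrite /= !in_itv /= => /andP[xt ty].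
by rewrite (le_trans ax xt) (ltW (lt_le_trans ty yb)).
Qed.
End Uniform.

(** * The elimination game on a probability space *)

Section RandomRun.
Context {disp : measure_display} {T : measurableType disp} {R : realType}
  (P : probability T R) {K L : finType} (pr : L -> R) (cut : L -> {set K})
  (letter : nat -> T -> L).

Definition word (n : nat) (w : T) : seq L := mkseq (letter^~ w) n.

Context (word_measurable : forall s : seq L,
    measurable (word (size s) @^-1` [set s]))
  (word_law : forall s : seq L,
    P (word (size s) @^-1` [set s]) = (\prod_(l <- s) pr l)%:E).

Definition state (n : nat) (w : T) : {set K} := run cut [set: K]%SET (word n w).

(** Only finitely many words of length [n] exist, so any function of the state is a finite
    combination of indicators of word events; measurability and integrals reduce to
    [word_measurable] and [word_law]. *)
Lemma stateE n (f : {set K} -> R) w :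
  ((f (state n w))%:E = \sum_(s <- @words L n)
     (f (run cut [set: K]%SET s))%:E * (\1_(word (size s) @^-1` [set s]) w)%:E)%E.
Proof.
have wn : word n w \in @words L n by rewrite mem_words size_mkseq.
rewrite (bigD1_seq (word n w)) ?uniq_words//= big_seq_cond big1 => [|s /andP[sn sw]].
  by rewrite adde0 size_mkseq indicE mem_set// mule1.
rewrite indicE memNset ?mule0//= => ws; case/eqP: sw.
by rewrite -ws; move: sn; rewrite mem_words => /eqP ->.
Qed.

Lemma measurable_state n (f : {set K} -> R) :
  measurable_fun [set: T] (fun w => (f (state n w))%:E).
Proof.
under eq_fun do rewrite stateE.
apply: emeasurable_sum => s; apply: emeasurable_funM => //.
exact/measurable_EFinP/measurable_indic.
Qed.

Lemma integral_state n (f : {set K} -> R) : (forall A, 0 <= f A) ->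
  (\int[P]_w (f (state n w))%:E = (mean_run pr cut n f)%:E)%E.
Proof.
move=> f0; under eq_integral do rewrite stateE.
rewrite ge0_integral_sum//; last 2 first.
- move=> s; apply: emeasurable_funM => //.
  exact/measurable_EFinP/measurable_indic.
- by move=> s w _; rewrite mule_ge0 ?lee_fin.
rewrite /mean_run -sumEFin; apply: eq_bigr => s _.
rewrite ge0_integralZl_EFin//; last exact/measurable_EFinP/measurable_indic.
by rewrite integral_indic// setIT mulrC EFinM -word_law.
Qed.

Lemma measurable_state_set n (D : pred {set K}) : measurable [set w | D (state n w)].
Proof.
rewrite (_ : mkset _ =
  \bigcup_(s in [set s | s \in @words L n /\ D (run cut [set: K]%SET s)])
     (word (size s) @^-1` [set s])).
  apply: fin_bigcup_measurable => //.
  by apply: sub_finite_set (finite_seq (@words L n)) => s [].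
apply/seteqP; split=> [w Dw|w [s [sn Ds] /= ws]]; last first.
  by rewrite /= /state; move: sn; rewrite mem_words => /eqP <-; rewrite ws.
exists (word n w); first by split; [rewrite mem_words size_mkseq|].
by rewrite /= size_mkseq.
Qed.

Lemma prob_state n (D : pred {set K}) :
  P [set w | D (state n w)] = (mean_run pr cut n (fun A => (D A)%:R))%:E.
Proof.
rewrite -integral_state// -[X in P X]setIT -integral_indic//; last exact: measurable_state_set.
by apply: eq_integral => w _; rewrite indicE mem_setE.
Qed.

Definition never_single : set T := \bigcap_n [set w | (1 < #|state n w|)%N].

Lemma measurable_never_single : measurable never_single.
Proof.
by apply: bigcapT_measurable => n; exact: (measurable_state_set n (fun A : {set K} => (1 < #|A|)%N)).
Qed.

Context (pr_ge0 : forall l, 0 <= pr l) (pr_sum : \sum_l pr l = 1).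
Context (cut_law_splits : forall A : {set K},
  (1 < #|A|)%N -> 0 < \sum_(S | splits A S) cut_law pr cut S).

(** For every [n] the event lies in that of being undecided after [n] rounds, whose probability
    decays by [mean_run_decay]. *)
Lemma prob_never_single : P never_single = 0%E.
Proof.
have [r /andP[r0 r1] rP] := mean_run_decay pr_ge0 pr_sum cut_law_splits.
have H n : (P never_single <= (#|K|%:R * r ^+ n)%:E)%E.
  apply: (@le_trans _ _ (P [set w | (1 < #|state n w|)%N])).
    apply: le_measure; rewrite ?inE.
    - exact: measurable_never_single.
    - exact: (measurable_state_set n (fun A : {set K} => (1 < #|A|)%N)).
    - by move=> w /(_ n I).
  by rewrite (prob_state n (fun A : {set K} => (1 < #|A|)%N)) lee_fin.
apply/eqP; rewrite eq_le measure_ge0 andbT.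
have fP : P never_single \is a fin_num by rewrite fin_num_measure//; exact: measurable_never_single.
rewrite -(fineK fP) lee_fin.
have cv : #|K|%:R * r ^+ n @[n --> \oo] --> #|K|%:R * (0 : R).
  by apply: cvgMr; apply: cvg_expr; rewrite ger0_norm.
rewrite mulr0 in cv; rewrite -(cvg_lim _ cv)//.
apply: limr_ge; first by apply/cvg_ex; exists 0.
by apply: nearW => n; rewrite -lee_fin fineK.
Qed.
End RandomRun.
End Measure.

(** * Cuts around a data point *)

Section Cuts.
Local Open Scope classical_set_scope.
Local Open Scope ring_scope.
Context {R : realType}.

Definition between (s t theta : R) : bool := (s <= theta) != (t <= theta).

(** Half-open, because a threshold equal to a coordinate sends the point to the lower side. *)
Lemma betweenE (s t : R) :
  [set theta | between s t theta] = `[Num.min s t, Num.max s t[%classic.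
Proof.
apply/seteqP; split=> u /=; rewrite in_itv /= /between ge_min lt_max !ltNge;
  by case: (s <= u); case: (t <= u).
Qed.

Lemma measurable_between (s t : R) : measurable [set theta | between s t theta].
Proof. by rewrite betweenE; exact: measurable_itv. Qed.

Lemma max_min_norm (s t : R) : Num.max s t - Num.min s t = `|s - t|.
Proof.
have [st|ts] := leP s t; first by rewrite distrC ger0_norm ?subr_ge0.
by rewrite ger0_norm// subr_ge0 ltW.
Qed.

(* The points between [s] and [i] but not between [s] and [q] fill an interval
   that stays inside [[a, b]] even if [s] does not. *)
Lemma between_detour (a b s i q : R) : a <= i <= b -> a <= q <= b ->
  exists u v, [/\ a <= u, v <= b, `|s - i| <= `|s - q| + (v - u) &
    `[u, v[%classic `<=` [set theta | between s i theta && ~~ between s q theta]].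
Proof.
move=> /andP[ai ib] /andP[aq qb].
(* The interval is empty if [i] lies between [s] and [q]; otherwise it joins [i] to the nearer of
   [s] and [q]. If that is [s], then [s] lies between [i] and [q], hence in [[a, b]]. *)
have [is_|si] := leP i s; have [qi|iq] := leP q i.
- exists i, i; split=> //; last by move=> t /=; rewrite in_itv /=; lra.
  rewrite !ger0_norm ?subr_ge0//; lra.
- have [qs|sq] := leP q s.
    exists i, q; split=> //; first by rewrite !ger0_norm ?subr_ge0//; lra.
    move=> t /=; rewrite in_itv /= /between => /andP[it tq].
    have /negbTE -> : ~~ (s <= t) by rewrite -ltNge; lra.
    have /negbTE -> : ~~ (q <= t) by rewrite -ltNge; lra.
    by rewrite it.
  exists i, s; split=> //; [lra| |].
    rewrite [leLHS]ger0_norm ?subr_ge0//; have := normr_ge0 (s - q); lra.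
  move=> t /=; rewrite in_itv /= /between => /andP[it ts].
  have /negbTE -> : ~~ (s <= t) by rewrite -ltNge; lra.
  have /negbTE -> : ~~ (q <= t) by rewrite -ltNge; lra.
  by rewrite it.
- have [qs|sq] := leP q s.
    exists s, i; split=> //; [lra| |].
      rewrite [leLHS]ler0_norm ?subr_le0 ?(ltW si)?(ltW iq)//; have := normr_ge0 (s - q); lra.
    move=> t /=; rewrite in_itv /= /between => /andP[st ti].
    have /negbTE -> : ~~ (i <= t) by rewrite -ltNge; lra.
    have -> : (q <= t) by lra.
    by rewrite st.
  exists q, i; split=> //.
    by rewrite !ler0_norm ?subr_le0 ?(ltW si)?(ltW iq)//; lra.
  move=> t /=; rewrite in_itv /= /between => /andP[qt ti].
  have /negbTE -> : ~~ (i <= t) by rewrite -ltNge; lra.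
  have -> : (s <= t) by lra.
  by rewrite qt.
- exists i, i; split=> //; last by move=> t /=; rewrite in_itv /=; lra.
  rewrite !ler0_norm ?subr_le0 ?(ltW si)?(ltW iq)//; lra.
Qed.

Context {d : nat} (C : {fset 'rV[R]_d}) (x : 'rV[R]_d).

Definition cut_off (j : 'I_d) (theta : R) : {set C} :=
  [set c : C | between (x 0 j) (val c 0 j) theta]%SET.

Lemma measurable_cut_off j S : measurable (cut_off j @^-1` [set S]).
Proof.
pose B (c : C) := [set theta | between (x 0 j) (val c 0 j) theta].
rewrite (_ : _ @^-1` _ = \bigcap_(c in [set: C]) if c \in S then B c else ~` B c).
  apply: fin_bigcap_measurable => // c _; case: ifP => _; last apply: measurableC;
  exact: measurable_between.
apply/seteqP; split=> t /=.
  by move=> <- c _; rewrite inE; case: ifPn => // /negP.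
move=> H; apply/setP => c; rewrite inE; have := H c I.
by case: ifP => _; rewrite /B /=; [|move/negP/negbTE].
Qed.

Lemma max_coord_ge c j : c \in C -> `|c 0 j| <= max_coord C.
Proof.
move=> cC; rewrite /max_coord.
apply: (@le_trans _ _ (\big[Num.max/0]_(j < d) `|c 0 j|)).
  exact: (le_bigmax _ (fun j => `|c 0 j|)).
exact: (@bigmax_sup_seq _ _ _ _ _ c).
Qed.

Context (ltM : - max_coord C < max_coord C).
Let M := max_coord C.
Let U := uniform_prob ltM.

(** A round seen from [x]: the threshold is remembered only through the set that it cuts off, which
    makes the alphabet finite. *)
Definition letter_law (l : 'I_d * {set C}) : R :=
  d%:R^-1 * fine (U (cut_off l.1 @^-1` [set l.2])).

Definition offcut_law : {set C} -> R := cut_law letter_law (@snd 'I_d {set C}).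

Lemma letter_law_ge0 l : 0 <= letter_law l.
Proof. by rewrite mulr_ge0 ?invr_ge0// fine_ge0. Qed.

Lemma offcut_law_pred (D : pred {set C}) :
  \sum_(S | D S) offcut_law S =
  d%:R^-1 * \sum_j fine (U [set theta | D (cut_off j theta)]).
Proof.
have -> : \sum_(S | D S) offcut_law S = \sum_(l | D l.2) letter_law l.
  rewrite [RHS](partition_big snd D)//=; apply: eq_bigr => S DS.
  by apply: eq_bigl => l; have [->|] := eqVneq l.2 S; rewrite ?DS ?andbF.
rewrite mulr_sumr -(pair_big_dep predT (fun _ S => D S) (fun j S => letter_law (j, S))) /=.
apply: eq_bigr => j _.
have -> : (U [set theta | D (cut_off j theta)] =
    \sum_(S | D S) U (cut_off j @^-1` [set S]))%E.
  by apply: measure_finType_valued => S; exact: measurable_cut_off.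
rewrite -sum_fine; last by move=> S _; rewrite fin_num_measure//; exact: measurable_cut_off.
by rewrite mulr_sumr.
Qed.

Lemma letter_law_sum : (0 < d)%N -> \sum_l letter_law l = 1.
Proof.
move=> d0; transitivity (\sum_(S | predT S) offcut_law S); first exact: partition_big.
rewrite offcut_law_pred.
rewrite (eq_bigr (fun=> 1)) => [|j _]; last first.
  rewrite (_ : mkset _ = setT); last by apply/seteqP; split.
  by have -> : U setT = 1%E by exact: probability_setT.
by rewrite sumr_const card_ord mulVf// pnatr_eq0 -lt0n.
Qed.

Let width := M - - M.

Let center_bound (c : C) j : - M <= val c 0 j <= M.
Proof. by rewrite -ler_norml max_coord_ge// (valP c). Qed.

Let width_gt0 : 0 < width.
Proof. by rewrite subr_gt0. Qed.

Let measurable_pred (D : pred {set C}) j : measurable [set theta | D (cut_off j theta)].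
Proof. by apply: measurable_finType_valued => S; exact: measurable_cut_off. Qed.

(** In coordinate [j], thresholds separating [x] from [p] fill an interval of length [|x_j - p_j|],
    possibly leaving [[-M, M]]; hence only an inequality. *)
Lemma offcut_law_mem_le (p : C) : (0 < d)%N ->
  width * d%:R * \sum_(S : {set C} | p \in S) offcut_law S <= l1norm (x - val p).
Proof.
move=> d0; have dn0 : d%:R != 0 :> R by rewrite pnatr_eq0 -lt0n.
rewrite (offcut_law_pred (fun S => p \in S)) mulrA mulfK// mulr_sumr.
apply: ler_sum => j _; rewrite !mxE -ler_pdivlMl// mulrC -max_min_norm.
apply: uniform_prob_itv_le; first exact: (measurable_pred (fun S => p \in S)).
  by rewrite le_max ge_min lexx.
by rewrite -betweenE => t /=; rewrite inE.
Qed.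

(** [between_detour] in each coordinate: both centers lie in [[-M, M]], so the detour interval has
    full uniform mass wherever [x] lies. *)
Lemma l1norm_le_loss (p i : C) : (0 < d)%N ->
  l1norm (x - val i) <= l1norm (x - val p) + width * d%:R * loss offcut_law p i.
Proof.
move=> d0; have dn0 : d%:R != 0 :> R by rewrite pnatr_eq0 -lt0n.
rewrite /loss (offcut_law_pred (fun S => (i \in S) && (p \notin S))) mulrA mulfK//.
rewrite mulr_sumr -big_split /=; apply: ler_sum => j _; rewrite !mxE.
have [u [v [Mu vM detour sub]]] :=
  between_detour (x 0 j) (center_bound i j) (center_bound p j).
apply: le_trans detour _; rewrite lerD2l -ler_pdivrMl// mulrC; apply: uniform_prob_itv_ge => //.
  exact: (measurable_pred (fun S => (i \in S) && (p \notin S))).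
by move=> t /sub /=; rewrite !inE.
Qed.

(** Two distinct centers of [A] differ in some coordinate, and the thresholds between them there
    have positive mass; each such cut removes exactly one of the two. *)
Lemma offcut_law_splits (A : {set C}) : (1 < #|A|)%N ->
  0 < \sum_(S | splits A S) offcut_law S.
Proof.
case/card_gt1P => a [b [aA bA ab]].
have [j jab] : exists j, val a 0 j != val b 0 j.
  apply/existsP; apply: contra_neqT ab; rewrite negb_exists => /forallP H.
  by apply/val_inj/rowP => j; apply/eqP; have := H j; rewrite negbK.
have d0 : (0 < d)%N by exact: leq_ltn_trans (ltn_ord j).
pose D (S : {set C}) := (a \in S) != (b \in S).
apply: (@lt_le_trans _ _ (\sum_(S | D S) offcut_law S)).
  rewrite offcut_law_pred mulr_gt0 ?invr_gt0 ?ltr0n//.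
  rewrite (bigD1 j)//= ltr_pwDl ?sumr_ge0//; last by move=> i _; rewrite fine_ge0.
  apply: (@lt_le_trans _ _ (`|val a 0 j - val b 0 j| / width)).
    by rewrite divr_gt0// normr_gt0 subr_eq0.
  rewrite -max_min_norm; apply: uniform_prob_itv_ge.
  - exact: measurable_pred.
  - by rewrite le_min; have /andP[-> _] := center_bound a j; have /andP[-> _] := center_bound b j.
  - by rewrite ge_max; have /andP[_ ->] := center_bound a j; have /andP[_ ->] := center_bound b j.
  (* The side of [x] cancels: exactly one of [a] and [b] is cut off when the threshold separates
     them. *)
  - rewrite -betweenE => t; rewrite /between /D /= !inE /between.
    by case: (_ <= _); case: (_ <= _); case: (_ <= _).
rewrite [leLHS]big_mkcond [leRHS]big_mkcond; apply: ler_sum => S _.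
have [DS|_] := boolP (D S); last first.
  by case: ifP => // _; apply: cut_law_ge0; exact: letter_law_ge0.
suff -> : splits A S by [].
move: DS; rewrite /D /splits; case aS: (a \in S); case bS: (b \in S) => // _.
  by apply/andP; split; apply/set0Pn; [exists a|exists b]; rewrite !inE ?aS ?bS ?aA ?bA.
by apply/andP; split; apply/set0Pn; [exists b|exists a]; rewrite !inE ?aS ?bS ?aA ?bA.
Qed.

(** [l1norm_le_loss] is averaged over the winner and [mean_loss_le] bounds the mean loss;
    [offcut_law_mem_le] then absorbs the factor [width * d]. One of the two units in the constant is
    the distance to [p] itself. *)
Lemma mean_winner_dist_le (p : C) : (0 < d)%N ->
  \sum_(i : C) winner offcut_law [set: C]%SET i * l1norm (x - val i) <=
  (2 + ln #|` C|%:R) * l1norm (x - val p).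
Proof.
move=> d0; pose W := winner offcut_law [set: C]%SET.
have W0 i : 0 <= W i by apply: winner_ge0 => S; apply: cut_law_ge0; exact: letter_law_ge0.
have Z0 : 0 <= width * d%:R by rewrite mulr_ge0 ?ler0n// ltW.
have mu0 S : 0 <= offcut_law S by apply: cut_law_ge0; exact: letter_law_ge0.
have W1 : \sum_i W i = 1.
  apply: winner_sum => //; first exact: offcut_law_splits.
  by apply/set0Pn; exists p; rewrite finset.in_setT.
apply: (@le_trans _ _ (l1norm (x - val p) +
    width * d%:R * mean_loss offcut_law p [set: C]%SET)).
  apply: (@le_trans _ _ (\sum_i W i * (l1norm (x - val p) +
      width * d%:R * loss offcut_law p i))).
    by apply: ler_sum => i _; rewrite ler_wpM2l//; exact: l1norm_le_loss.
  under eq_bigr do rewrite mulrDr mulrCA.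
  by rewrite big_split /= -mulr_suml W1 mul1r -mulr_sumr.
have := mean_loss_le mu0 offcut_law_splits p; rewrite -cardfE => /(ler_wpM2l Z0) H.
have k1 : 1 <= #|` C|%:R :> R.
  by rewrite ler1n cardfs_gt0; apply/fset0Pn; exists (val p); exact: valP.
have := offcut_law_mem_le p d0 => /(ler_wpM2l (addr_ge0 (@ler01 R) (ln_ge0 k1))) H2.
rewrite (_ : 2 + ln _ = 1 + (1 + ln #|` C|%:R)); last by ring.
rewrite [leRHS]mulrDl mul1r lerD2l; apply: le_trans H _.
by rewrite mulrCA.
Qed.
End Cuts.

(** * The letters read off from the uniform cuts *)

Section Letters.
Local Open Scope classical_set_scope.
Local Open Scope ring_scope.
Context {R : realType} {d : nat} (C : {fset 'rV[R]_d}) (x : 'rV[R]_d)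
  {disp : measure_display} {T : measurableType disp} (P : probability T R)
  (j : nat -> T -> 'I_d) (theta : nat -> {RV P >-> R})
  (ltM : - max_coord C < max_coord C)
  (cuts : uniform_cuts (max_coord C) j theta).

Definition letter (n : nat) (w : T) : 'I_d * {set C} :=
  (j n w, cut_off C x (j n w) (theta n w)).

(** Once the coordinate of a round is prescribed, the set cut off depends on the threshold alone;
    the word event thus becomes an intersection of events about single draws. *)
Lemma letter_wordE l0 s : word letter (size s) @^-1` [set s] =
  \bigcap_(m in `I_(size s)) ((j m @^-1` [set (nth l0 s m).1]) `&`
     (theta m @^-1` (cut_off C x (nth l0 s m).1 @^-1` [set (nth l0 s m).2]))).
Proof.
apply/seteqP; split=> [w /= ws m ms|w ws].
  by rewrite -ws !nth_mkseq//.
apply: (@eq_from_nth _ l0); first by rewrite size_mkseq.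
rewrite size_mkseq => m ms; rewrite nth_mkseq//.
have [/= jm cm] := ws m ms; rewrite /letter jm cm.
by case: (nth l0 s m).
Qed.


Lemma letter_word_measurable (s : seq ('I_d * {set C})) :
  measurable (word letter (size s) @^-1` [set s]).
Proof.
case: s => [|l0 s].
  rewrite (_ : _ @^-1` _ = setT); first exact: measurableT.
  by apply/seteqP; split.
rewrite (letter_wordE l0); apply: fin_bigcap_measurable => [|m _]; first exact: finite_II.
apply: measurableI; first exact: (coord_measurable cuts).
by apply: measurable_funPTI; exact: measurable_cut_off.
Qed.

Lemma letter_word_law (s : seq ('I_d * {set C})) :
  P (word letter (size s) @^-1` [set s]) = (\prod_(l <- s) letter_law x ltM l)%:E.
Proof.
case: s => [|l0 s].
  rewrite (_ : _ @^-1` _ = setT); first by rewrite probability_setT big_nil.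
  by apply/seteqP; split.
move: (l0 :: s) => {}s.
(* Coordinate and threshold draws are listed together, so that a single use of independence factors
   the whole word event. *)
pose I : seq (nat + nat) := map inl (iota 0 (size s)) ++ map inr (iota 0 (size s)).
pose E (i : nat + nat) := match i with
  | inl m => j m @^-1` [set (nth l0 s m).1]
  | inr m => theta m @^-1` (cut_off C x (nth l0 s m).1 @^-1` [set (nth l0 s m).2])
  end.
have Iuniq : uniq I.
  rewrite cat_uniq !map_inj_uniq ?iota_uniq ?andbT//=; last 2 first.
  - by move=> a b [].
  - by move=> a b [].
  by apply/hasPn => _ /mapP[m _ ->]; apply/mapP => -[].
have [J JI] : exists J : {fset (nat + nat)}, J =i I.
  by exists (seq_fset tt I); exact: seq_fsetE.
rewrite (letter_wordE l0).
rewrite (_ : \bigcap_(m in _) _ = \bigcap_(i in [set` J]) E i); last first.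
  apply/seteqP; split=> w H.
    move=> i /=; rewrite JI mem_cat => /orP[] /mapP[m]; rewrite mem_iota add0n /= => ms ->;
    by have [] := H m ms.
  move=> m /= ms; split; [apply: (H (inl m))|apply: (H (inr m))];
    rewrite /= JI mem_cat; apply/orP; [left|right];
    by apply: map_f; rewrite mem_iota.
rewrite (draws_independent cuts); last first.
  move=> [m|m] _ /=; first by exists [set (nth l0 s m).1].
  exists (cut_off C x (nth l0 s m).1 @^-1` [set (nth l0 s m).2]) => //.
  exact: measurable_cut_off.
have -> : (\prod_(i <- J) P (E i) = \prod_(i <- I) P (E i))%E.
  by apply: perm_big; apply: uniq_perm (fset_uniq _) Iuniq JI.
rewrite big_cat /= !big_map.
rewrite (eq_bigr (fun m => (d%:R^-1)%:E)) => [|m _]; last exact: (coord_uniform cuts).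
rewrite [X in (_ * X)%E](eq_bigr (fun m => (fine (uniform_prob ltM
    (cut_off C x (nth l0 s m).1 @^-1` [set (nth l0 s m).2])))%:E)) => [|m _]; last first.
  rewrite fineK ?fin_num_measure//; last exact: measurable_cut_off.
  by rewrite -(threshold_uniform cuts m)//; exact: measurable_cut_off.
rewrite !prodEFin -EFinM -big_split /=; congr EFin.
by rewrite (big_nth l0) /index_iota subn0.
Qed.
End Letters.

(** * Threshold trees *)

Section Trees.
Local Open Scope classical_set_scope.
Local Open Scope fset_scope.
Local Open Scope ring_scope.
Context {R : realType} {d : nat}.
Implicit Types (x c : 'rV[R]_d) (A C X : {fset 'rV[R]_d}) (t : tree R d).

Fixpoint centers_at x t : {fset 'rV[R]_d} :=
  match t with
  | Leaf A => A
  | Node j theta l r => if x 0 j <= theta then centers_at x l else centers_at x r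
  end.

Definition same_side x j theta A : {fset 'rV[R]_d} :=
  [fset c in A | ~~ between (x 0 j) (c 0 j) theta].

(** If the side of [x] holds no center of the leaf, the leaf is not split and keeps [A]; if the
    other side holds none, it is not split either and [B] equals [A]. This is the rule of
    [survivors]. *)
Lemma centers_at_split x j theta t :
  centers_at x (split_leaves j theta t) =
  let A := centers_at x t in
  let B := same_side x j theta A in if B == fset0 then A else B.
Proof.
elim: t => [A|j' theta' l IHl r IHr] /=; last by case: ifP.
have B_eq : same_side x j theta A =
    if x 0 j <= theta then lower_part j theta A else upper_part j theta A.
  rewrite /same_side /between; apply/fsetP => c; case: ifP => xj;
    rewrite !inE; case: (c \in A) => //=; rewrite ?ltNge; by case: (c 0 j <= theta).
have LU : lower_part j theta A = fset0 -> upper_part j theta A = A.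
  move=> L0; apply/fsetP => c; rewrite !inE andbC; case: (boolP (c \in A)) => [cA|]; last by rewrite andbF.
  rewrite andbT ltNge; apply/negP => ct.
  have : c \in lower_part j theta A by rewrite !inE cA.
  by rewrite L0 inE.
have UL : upper_part j theta A = fset0 -> lower_part j theta A = A.
  move=> U0; apply/fsetP => c; rewrite !inE andbC; case: (boolP (c \in A)) => [cA|]; last by rewrite andbF.
  rewrite andbT leNgt; apply/negP => ct.
  have : c \in upper_part j theta A by rewrite !inE cA.
  by rewrite U0 inE.
rewrite B_eq; case: ifP => [/andP[Ln0 Un0]|] /=.
  by case: ifP => _; rewrite ?(negbTE Ln0) ?(negbTE Un0).
move/negbT; rewrite negb_and !negbK => /orP[]/eqP E0.
  by rewrite E0 (LU E0); case: (x 0 j <= theta); rewrite ?eqxx//; case: ifP.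
by rewrite E0 (UL E0); case: (x 0 j <= theta); rewrite ?eqxx//; case: ifP.
Qed.

Lemma median_cost_le X c : median_cost X <= \sum_(x <- X) l1norm (x - c).
Proof.
apply: ge_inf; last by exists c.
by exists 0 => _ [y _ <-]; apply: sumr_ge0 => z _; apply: sumr_ge0.
Qed.

Lemma median_cost_ge0 X : 0 <= median_cost X.
Proof.
apply: lb_le_inf; first by exists (\sum_(x <- X) l1norm (x - 0)), 0.
by move=> _ [y _ <-]; apply: sumr_ge0 => z _; apply: sumr_ge0.
Qed.

Lemma tree_cost_ge0 X t : 0 <= tree_cost X t.
Proof. by apply: sumr_ge0 => Y _; exact: median_cost_ge0. Qed.

(** All points of a cluster share the single center of their leaf, which is a candidate in the
    infimum defining the median cost. *)
Lemma tree_cost_le X t (h : 'rV[R]_d -> 'rV[R]_d) :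
  (forall x, x \in X -> centers_at x t = [fset h x]) ->
  tree_cost X t <= \sum_(x <- X) l1norm (x - h x).
Proof.
rewrite /tree_cost; elim: t X => [A|j theta l IHl r IHr] X hX /=.
  (* An empty cluster offers no point at which to evaluate [h]; there the candidate 0 gives cost
     zero. *)
  rewrite big_seq1; have [->|[y yX]] := fset_0Vmem X.
    by apply: le_trans (median_cost_le _ 0) _; rewrite !big_seq_fset0.
  apply: le_trans (median_cost_le _ (h y)) _; rewrite big_seq [leRHS]big_seq.
  apply: ler_sum => x xX; suff -> : h x = h y by [].
  by apply/fset1P; have /= <- := hX _ yX; have /= -> := hX _ xX; exact: fset11.
rewrite big_cat /=.
have -> : \sum_(x <- X) l1norm (x - h x) =
    \sum_(x <- lower_part j theta X) l1norm (x - h x) +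
    \sum_(x <- upper_part j theta X) l1norm (x - h x).
  rewrite (big_fsetID _ (fun x => x 0 j <= theta)) /=; congr (_ + _).
  by apply: eq_fbigl => x; rewrite !inE ltNge.
apply: lerD.
  by apply: IHl => x; rewrite !inE => /andP[xX xj]; have := hX x xX; rewrite /= xj.
apply: IHr => x; rewrite !inE => /andP[xX xj]; have := hX x xX.
by rewrite /= leNgt xj.
Qed.

(** The invariant that the set recorded at a leaf is what routing [A] down the tree brings there; an
    arbitrary [tree] may record any set. *)
Fixpoint consistent A t : Prop :=
  match t with
  | Leaf B => B = A
  | Node j theta l r =>
      consistent (lower_part j theta A) l /\ consistent (upper_part j theta A) r
  end.

Lemma consistent_split A j theta t :
  consistent A t -> consistent A (split_leaves j theta t).
Proof.
elim: t A => [B|j' theta' l IHl r IHr] A /=; last by case; auto.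
by move=> ->; case: ifP.
Qed.

Lemma consistent_after C j theta n : consistent C (tree_after C j theta n).
Proof. by elim: n => //= n; exact: consistent_split. Qed.

Lemma consistent_centers_at A t B c : consistent A t -> B \in leaf_centers t ->
  c \in B -> c \in A /\ centers_at c t = B.
Proof.
elim: t A => [D|j theta l IHl r IHr] A /=.
  by move=> ->; rewrite inE => /eqP ->.
move=> [cl cr]; rewrite mem_cat => /orP[] Bt cB.
  have [] := IHl _ cl Bt cB; rewrite !inE => /andP[-> cj] ->.
  by rewrite cj.
have [] := IHr _ cr Bt cB; rewrite !inE => /andP[-> cj] ->.
by rewrite leNgt cj.
Qed.

Lemma centers_at_leaf x t : centers_at x t \in leaf_centers t.
Proof.
elim: t => [A|j theta l IHl r IHr] /=; first by rewrite inE.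
by rewrite mem_cat; case: ifP => _; rewrite ?IHl ?IHr ?orbT.
Qed.

Definition center_set C A : {set C} := [set c : C | val c \in A]%SET.

Section Run.
Context (C : {fset 'rV[R]_d}) (C0 : C != fset0) (j : nat -> 'I_d) (theta : nat -> R).

Lemma centers_at_sub x n : centers_at x (tree_after C j theta n) `<=` C.
Proof.
elim: n => [|n IHn] /=; first exact: fsubset_refl.
rewrite centers_at_split /=; case: ifP => // _.
by apply: fsubset_trans IHn; apply/fsubsetP => c; rewrite !inE => /andP[].
Qed.

Lemma centers_at_neq0 x n : centers_at x (tree_after C j theta n) != fset0.
Proof.
elim: n => //= n IHn.
by rewrite centers_at_split /=; case: ifPn.
Qed.

Lemma center_set_eq0 A : A `<=` C -> (center_set C A == finset.set0) = (A == fset0).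
Proof.
move=> /fsubsetP AC; apply/eqP/eqP => [A0|->]; last by apply/setP => c; rewrite !inE.
apply/eqP; apply: contraPT A0 => /fset0Pn[c cA].
by apply/eqP/set0Pn; exists [` AC c cA]; rewrite inE.
Qed.

(** The bridge from trees to the game: seen from [x], each round of the algorithm is one elimination
    step. *)
Lemma center_set_run x n : center_set C (centers_at x (tree_after C j theta n)) =
  run snd [set: C]%SET (mkseq (fun m => (j m, cut_off C x (j m) (theta m))) n).
Proof.
elim: n => [|n IHn]; first by apply/setP => c; rewrite !inE; exact: valP.
rewrite mkseqS run_rcons -IHn /= centers_at_split /survivors /=.
set A := centers_at _ _; set B := same_side _ _ _ _.
have AC : A `<=` C by exact: centers_at_sub.
have BE : (center_set C A :\: cut_off C x (j n) (theta n))%SET = center_set C B.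
  by apply/setP => c; rewrite !inE /= andbC.
rewrite BE center_set_eq0; first by case: ifP.
by apply: fsubset_trans AC; apply/fsubsetP => c; rewrite !inE => /andP[].
Qed.

Lemma finished_centers_at x n : finished (tree_after C j theta n) ->
  exists2 c, c \in C & centers_at x (tree_after C j theta n) = [fset c].
Proof.
move=> /allP /(_ _ (centers_at_leaf x _)) A1.
have /cardfs1P[c Ac] : #|` centers_at x (tree_after C j theta n)| == 1%N.
  by rewrite eqn_leq A1 cardfs_gt0 centers_at_neq0.
by exists c => //; have /fsubsetP := centers_at_sub x n; apply; rewrite Ac fset11.
Qed.

(** A center of a crowded leaf, taken as a data point, is routed to that leaf. Termination can
    therefore be tested on the finitely many games started from centers. *)
Lemma unfinished_centers_at n : ~~ finished (tree_after C j theta n) ->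
  exists y : C, (1 < #|center_set C (centers_at (val y) (tree_after C j theta n))|)%N.
Proof.
move=> /allPn[A At]; rewrite -ltnNge => A1.
have /fset0Pn[a aA] : A != fset0 by rewrite -cardfs_gt0 ltnW.
have [b] : exists b, b \in A `\ a.
  by apply/fset0Pn; rewrite -cardfs_gt0; move: A1; rewrite (cardfsD1 a) aA.
rewrite !inE => /andP[ba bA].
have [aC aAt] := consistent_centers_at (consistent_after C j theta n) At aA.
have [bC _] := consistent_centers_at (consistent_after C j theta n) At bA.
exists [` aC]; rewrite /= aAt; apply/card_gt1P; exists [` aC], [` bC].
by rewrite !inE /= aA bA; split => //; rewrite -val_eqE /= eq_sym.
Qed.
End Run.
End Trees.

(** * Expected cost *)

Section ExpectedCost.
Import numFieldNormedType.Exports.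
Local Open Scope classical_set_scope.
Local Open Scope ring_scope.

Lemma limn_einf_ge (R : realType) (u : (\bar R)^nat) (a : \bar R) (N : nat) :
  (forall n, (N <= n)%N -> (a <= u n)%E) -> (a <= limn_einf u)%E.
Proof.
move=> au; rewrite limn_einf_lim; apply: lime_ge; first exact: is_cvg_einfs.
exists N => // n /= Nn; apply: le_ereal_inf_tmp => _ [m /= nm <-].
exact: au (leq_trans Nn nm).
Qed.

Context {R : realType} {d : nat} (X C : {fset 'rV[R]_d})
  {disp : measure_display} {T : measurableType disp} (P : probability T R)
  (j : nat -> T -> 'I_d) (theta : nat -> {RV P >-> R})
  (ltM : - max_coord C < max_coord C)
  (cuts : uniform_cuts (max_coord C) j theta)
  (C0 : C != fset0) (d0 : (0 < d)%N).

Let reached (x : 'rV[R]_d) (n : nat) (w : T) : {set C} :=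
  state snd (letter C x j theta) n w.

Let mu (x : 'rV[R]_d) := offcut_law x ltM.

(** The expected distance from [x] to the winner when the game stands at [A]; for a single center it
    is the actual distance. *)
Let value (x : 'rV[R]_d) (A : {set C}) : R :=
  \sum_(i : C) winner (mu x) A i * l1norm (x - val i).

Let mu_ge0 x S : 0 <= mu x S.
Proof. by apply: cut_law_ge0; exact: letter_law_ge0. Qed.

Let value_ge0 x A : 0 <= value x A.
Proof.
apply: sumr_ge0 => i _; rewrite mulr_ge0//.
  by apply: winner_ge0; exact: mu_ge0.
by apply: sumr_ge0.
Qed.

Lemma integral_value x n :
  (\int[P]_w (value x (reached x n w))%:E = (value x [set: C]%SET)%:E)%E.
Proof.
rewrite (integral_state snd (letter_word_measurable x cuts) (letter_word_law x ltM cuts))//.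
rewrite mean_run_sum; congr EFin; apply: eq_bigr => i _; rewrite mean_runZ; congr (_ * _).
apply: mean_run_winner.
- exact: letter_law_sum.
- exact: offcut_law_splits.
Qed.

Definition never_finished : set T :=
  \bigcup_(y in [set: C]) never_single snd (letter C (val y) j theta).

Lemma measurable_never_finished : measurable never_finished.
Proof.
apply: fin_bigcup_measurable => // y _; apply: measurable_never_single.
exact: letter_word_measurable.
Qed.

Lemma prob_never_finished : P never_finished = 0%E.
Proof.
have null (s : seq C) :
    P (\big[setU/set0]_(y <- s) never_single snd (letter C (val y) j theta)) = 0%E.
  elim: s => [|y s IHs]; first by rewrite big_nil measure0.
  rewrite big_cons measureU0//.
  - apply: prob_never_single (letter_word_law (val y) ltM cuts) _ _ _.
    + exact: letter_word_measurable.
    + exact: letter_law_ge0.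
    + exact: letter_law_sum.
    + exact: offcut_law_splits.
  - by apply: measurable_never_single; exact: letter_word_measurable.
  - apply: bigsetU_measurable => z _; apply: measurable_never_single.
    exact: letter_word_measurable.
rewrite -(null (enum {: C})) -bigcup_seq; congr (P _).
by apply/seteqP; split=> w [y _ yw]; exists y => //=; rewrite mem_enum.
Qed.

Lemma center_set_reached x n w :
  center_set C (centers_at x (tree_after C (j^~ w) (fun m => theta m w) n)) = reached x n w.
Proof. exact: center_set_run. Qed.

Lemma reached_sub x n m w : (n <= m)%N -> reached x m w \subset reached x n w.
Proof.
move=> /subnK <-; elim: (m - n)%N => // l; apply: fintype.subset_trans.
rewrite addSn /reached /state /word mkseqS run_rcons; exact: survivors_sub.
Qed.

(** If the game of every center [y] is decided by some round [N y], then all are decided by the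
    maximum of the [N y], as states only shrink; the tree is then finished. *)
Lemma never_finishedP w :
  (forall n, ~~ finished (tree_after C (j^~ w) (fun m => theta m w) n)) ->
  never_finished w.
Proof.
move=> unfinished; apply: contrapT => notw.
have /choice[N HN] (y : C) : exists n, (#|reached (val y) n w| <= 1)%N.
  apply: contrapT => H; apply: notw; exists y => // n _ /=.
  by rewrite ltnNge; apply/negP => H1; apply: H; exists n.
have [y] := unfinished_centers_at (unfinished (\max_y N y)).
rewrite center_set_reached ltnNge (leq_trans _ (HN y))//.
by apply: subset_leq_card; apply: reached_sub; exact: leq_bigmax.
Qed.

(** A measurable substitute for the cost. The infinite term sits on a null event containing all runs
    that never end, so it leaves the integral unchanged. *)
Let approx (n : nat) (w : T) : \bar R :=
  (\sum_(x <- X) (value x (reached x n w))%:E +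
   (if w \in never_finished then +oo else 0))%E.

(** From the exit round on, every game is frozen at one center, and [value] is the distance to it;
    in a run without exit every [approx n w] is infinite. *)
Lemma output_cost_le_approx w :
  (output_cost X (random_coordinate_cut C (j^~ w) (fun n => theta n w)) <=
   limn_einf (approx^~ w))%E.
Proof.
rewrite /random_coordinate_cut; case: pselect => [fin|nfin] /=; last first.
  apply: (@limn_einf_ge _ _ _ 0%N) => n _; rewrite /approx mem_set; last first.
    apply: never_finishedP => m; apply/negP => H; apply: nfin; by exists m.
  rewrite addey// gt_eqF// (lt_le_trans ltNy0)// sume_ge0// => x _.
  by rewrite lee_fin.
case: ex_minnP => N Nfin _; apply: (@limn_einf_ge _ _ _ N) => n Nn.
have /boolp.choice[h hP] (x : 'rV[R]_d) : exists c : C,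
    centers_at x (tree_after C (j^~ w) (fun m => theta m w) N) = [fset val c]%fset.
  have [c cC ->] := finished_centers_at C0 x Nfin.
  by exists [` cC]%fset.
have reachedE x : reached x n w = [set h x]%SET.
  have H : reached x N w = [set h x]%SET.
    by rewrite -center_set_reached hP; apply/setP => c; rewrite !inE.
  have sub := reached_sub x w Nn.
  have n0 : reached x n w != finset.set0.
    rewrite -center_set_reached center_set_eq0 ?centers_at_neq0//.
    exact: centers_at_sub.
  by apply/eqP; move: sub n0; rewrite H finset.subset1 => /orP[//|->].
apply: (@le_trans _ _ (\sum_(x <- X) l1norm (x - val (h x)))%:E).
  by rewrite lee_fin; apply: tree_cost_le.
rewrite /approx -sumEFin -[leLHS]adde0; apply: leeD; last by case: ifP.
apply: lee_sum => x _; rewrite lee_fin reachedE /value (bigD1 (h x))//=.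
rewrite winner_small ?cards1// set11 mul1r lerDl sumr_ge0// => i _.
rewrite mulr_ge0 ?winner_ge0//; by [exact: mu_ge0|apply: sumr_ge0].
Qed.

Let measurable_value x n :
  measurable_fun [set: T] (fun w => (value x (reached x n w))%:E).
Proof. by apply: measurable_state; exact: letter_word_measurable. Qed.

Let measurable_unfinished :
  measurable_fun [set: T] (fun w => if w \in never_finished then +oo else 0 : \bar R)%E.
Proof.
apply: measurable_fun_if => //; apply: (measurable_fun_bool true).
rewrite setTI (_ : _ @^-1` _ = never_finished); first exact: measurable_never_finished.
by apply/seteqP; split=> w /=; [move/set_mem|move/mem_set].
Qed.

Lemma measurable_approx n : measurable_fun [set: T] (approx n).
Proof. by apply: emeasurable_funD => //; exact: emeasurable_sum. Qed.

Lemma integral_approx n :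
  (\int[P]_w approx n w = (\sum_(x <- X) value x [set: C]%SET)%:E)%E.
Proof.
rewrite /approx ge0_integralD//; last 3 first.
- by move=> w _; apply: sume_ge0 => x _; rewrite lee_fin.
- exact: emeasurable_sum.
- by move=> w _; case: ifP.
rewrite ge0_integral_sum//; last by move=> x w _; rewrite lee_fin.
under eq_bigr do rewrite integral_value.
rewrite sumEFin; set I := (X in (_ + X)%E); suff -> : I = 0%E by rewrite adde0.
transitivity (\int[P]_(w in never_finished) cst +oo w)%E.
  by rewrite [RHS]integral_mkcond; apply: eq_integral => w _; rewrite patchE.
rewrite integral_cst; last exact: measurable_never_finished.
by rewrite [X in (_ * X)%E]prob_never_finished mule0.
Qed.

Lemma expected_cost_le :
  (\int[P]_w output_cost X
      (random_coordinate_cut C (fun n => j n w) (fun n => theta n w))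
   <= ((2 + ln #|` C|%:R) * \sum_(x <- X) dist_to_centers C x)%:E)%E.
Proof.
have approx_ge0 n w : (0 <= approx n w)%E.
  rewrite /approx adde_ge0//; last by case: ifP.
  by apply: sume_ge0 => x _; rewrite lee_fin.
apply: (@le_trans _ _ (\int[P]_w limn_einf (approx^~ w))%E).
  apply: le_integral_ge0 => w; last exact: output_cost_le_approx.
  by case: random_coordinate_cut => //= t; rewrite lee_fin tree_cost_ge0.
apply: le_trans (fatou _ _ _ _) _ => //; first by move=> n; exact: measurable_approx.
under [X in limn_einf X]eq_fun do rewrite integral_approx.
(* The integrals do not depend on the round, so the limit inferior is that of a constant
   sequence. *)
rewrite (cvg_limn_einf_sup (cvg_cst _)).1 lee_fin mulr_sumr.
apply: ler_sum => x _.
have [c0 c0C] := fset0Pn _ C0.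
pose p := [arg min_(c < [` c0C]%fset) l1norm (x - val c)]%O.
have pmin c : c \in C -> l1norm (x - val p) <= l1norm (x - c).
  by rewrite /p; case: arg_minP => //= q _ qmin cC; exact: (qmin [` cC]%fset).
apply: le_trans (mean_winner_dist_le x ltM p d0) _.
rewrite ler_wpM2l//.
  by rewrite addr_ge0// ln_ge0// ler1n cardfs_gt0.
apply: lb_le_inf; first by exists (l1norm (x - c0)), c0.
by move=> _ [c cC <-]; exact: pmin.
Qed.
End ExpectedCost.

(** Treated apart because [max_coord] may be 0 here, which leaves no uniform law to work with. The
    loop exits at round 0, and [c] is a candidate center for the only cluster. *)
Lemma one_center_cost (R : realType) (d : nat) (X : {fset 'rV[R]_d}) (c : 'rV[R]_d)
    (j : nat -> 'I_d) (theta : nat -> R) :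
  (output_cost X (random_coordinate_cut [fset c]%fset j theta) <=
   (\sum_(x <- X) dist_to_centers [fset c]%fset x)%:E)%E.
Proof.
have fin0 : finished (tree_after [fset c]%fset j theta 0).
  by rewrite /finished /= cardfs1.
rewrite /random_coordinate_cut; case: pselect => [fin|[]]; last by exists 0%N.
case: ex_minnP => n _ /(_ 0%N fin0); rewrite leqn0 => /eqP -> /=.
rewrite lee_fin /tree_cost big_seq1; apply: le_trans (median_cost_le X c) _.
apply: ler_sum => x _; apply: lb_le_inf.
  by exists (l1norm (x - c)), c => //=; rewrite inE.
by move=> _ [y /= /fset1P -> <-].
Qed.

Local Open Scope classical_set_scope.
Local Open Scope fset_scope.
Local Open Scope ring_scope.

Theorem theorem2 (R : realType) (d k : nat) (X C : {fset 'rV[R]_d})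
    (hk : (0 < k)%N) (hC : #|` C| = k)
    (disp : measure_display) (T : measurableType disp) (P : probability T R)
    (j : nat -> T -> 'I_d) (theta : nat -> {RV P >-> R})
    (hcuts : uniform_cuts (max_coord C) j theta) :
  (\int[P]_w output_cost X
      (random_coordinate_cut C (fun n => j n w) (fun n => theta n w))
   <= ((2 * ln (k%:R : R) + 2) * \sum_(x <- X) dist_to_centers C x)%:E)%E.
Proof.
have C0 : C != fset0 by rewrite -cardfs_gt0 hC.
have ln0 : 0 <= ln (k%:R : R) by rewrite ln_ge0// ler1n.
have dist0 : 0 <= \sum_(x <- X) dist_to_centers C x.
  apply: sumr_ge0 => x _; apply: lb_le_inf.
    by have [c cC] := fset0Pn _ C0; exists (l1norm (x - c)), c.
  by move=> _ [c _ <-]; apply: sumr_ge0.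
have [k1|k1] := leqP k 1.
  have /cardfs1P[c Cc] : #|` C| == 1%N by rewrite hC eqn_leq k1 hk.
  apply: (@le_trans _ _ (\int[P]_w cst (\sum_(x <- X) dist_to_centers C x)%:E w)%E).
    apply: le_integral_ge0 => w; last by rewrite Cc; exact: one_center_cost.
    by case: random_coordinate_cut => //= t; rewrite lee_fin tree_cost_ge0.
  rewrite integral_cst// [X in (_ * X)%E]probability_setT mule1 lee_fin ler_peMl//; lra.
(* A probability space has a point, and the coordinate drawn there shows that [d] is positive. *)
have [w _] : [set: T] !=set0.
  apply/set0P; apply/eqP => T0; have := probability_setT P.
  by rewrite T0 measure0 => /esym/eqP; rewrite onee_eq0.
have d0 : (0 < d)%N by exact: leq_ltn_trans (ltn_ord (j 0%N w)).
have M0 : 0 < max_coord C.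
  rewrite lt_neqAle eq_sym andbC; apply/andP; split.
    have [c cC] := fset0Pn _ C0.
    exact: le_trans (max_coord_ge (Ordinal d0) cC).
  (* If the largest coordinate were 0, every center would be the origin, against [1 < k]. *)
  apply/eqP => M0; move: k1; rewrite -hC ltnNge => /negP; apply.
  suff : C `<=` [fset 0] by move=> /fsubset_leq_card; rewrite cardfs1.
  apply/fsubsetP => c cC; apply/fset1P/rowP => i; apply/eqP.
  by rewrite mxE -normr_le0 -M0 max_coord_ge.
have ltM : - max_coord C < max_coord C by rewrite gtrN.
apply: le_trans (expected_cost_le X ltM hcuts C0 d0) _.
(* The bound obtained has the constant [2 + ln k], which is at most [2 ln k + 2] as [ln k] is
   nonnegative. *)
rewrite hC lee_fin ler_wpM2r//; lra.
Qed.
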